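(* Let $K=K(X,\mathcal M,\alpha,r)$ be the PoSI constant. For every (measurable) model selection procedure $\hat M:\mathbb R^n\to\mathcal M$, writing $\hat M=\hat M(Y)$, $$P\Bigl[\max_{j\in\hat M}|t_{j\cdot\hat M}|\le K\Bigr]\ \ge\ 1-\alpha .$$
   Context: Setting. $X=(X_1,\dots,X_p)$ is a fixed real $n\times p$ matrix with $d=\operatorname{rank}(X)\ge 1$ ($n,p$ arbitrary). $Y\sim N(\mu,\sigma^2 I_n)$, where $\mu\in\mathbb R^n$ is arbitrary (not assumed to lie in the column space of $X$) and $\sigma>0$. $\hat\sigma>0$ is a random variable with $\hat\sigma^2\sim\sigma^2\chi^2_r/r$ ($r$ degrees of freedom; $r=\infty$ means $\hat\sigma=\sigma$), independent of all least squares estimates below. Submodels. For nonempty $M\subset\{1,\dots,p\}$, $X_M$ is the submatrix of columns indexed by $M$. $\mathcal M_{\mathrm{all}}=\{M: M\ne\varnothing,\ \operatorname{rank}(X_M)=|M|\}$. $\mathcal M$ is a fixed nonempty subset of $\mathcal M_{\mathrm{all}}$ with $\bigcup_{M\in\mathcal M}M=\{1,\dots,p\}$. For $M\in\mathcal M_{\mathrm{all}}$: $\hat\beta_M=(X_M^TX_M)^{-1}X_M^TY$ and $\beta_M=E[\hat\beta_M]=(X_M^TX_M)^{-1}X_M^T\mu$, with components $\hat\beta_{j\cdot M},\beta_{j\cdot M}$ indexed by $j\in M$. $X_{j\cdot M}$ ($j\in M$) is the residual vector of $X_j$ after orthogonal projection onto the span of $\{X_k:k\in M\setminus\{j\}\}$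 (equal to $X_j$ if $M=\{j\}$). Define $$t_{j\cdot M}=\frac{\hat\beta_{j\cdot M}-\beta_{j\cdot M}}{\hat\sigma/\|X_{j\cdot M}\|}=\frac{(Y-\mu)^TX_{j\cdot M}}{\hat\sigma\|X_{j\cdot M}\|}.$$ PoSI constant. For $\alpha\in(0,1)$, $K(X,\mathcal M,\alpha,r)$ is the minimal $K$ with $P[\max_{M\in\mathcal M}\max_{j\in M}|t_{j\cdot M}|\le K]\ge1-\alpha$. *)

(* Defs.v *)
From HB Require Import structures.
From mathcomp Require Import all_boot all_order all_algebra.
From mathcomp Require Import all_classical all_reals all_analysis.

Set Implicit Arguments.
Unset Strict Implicit.
Unset Printing Implicit Defensive.

Import Order.TTheory GRing.Theory Num.Theory.
Import numFieldNormedType.Exports.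

Local Open Scope classical_set_scope.
Local Open Scope ring_scope.

Section LeastSquares.
Context {R : realType} {n p : nat}.
Implicit Types (X : 'M[R]_(n, p)) (M : {set 'I_p}) (y mu : 'cV[R]_n).

(* The norm `|v| of the library is the sup norm. *)
Definition euclidean_norm (v : 'cV[R]_n) : R := Num.sqrt (\sum_i v i 0 ^+ 2).

(* The columns of X_M are numbered by 'I_#|M|: column k of X_M is column
   enum_val k of X. The coordinates of the least squares estimates in the
   submodel M are numbered in the same way. *)
Definition submodel_mx X M : 'M[R]_(n, #|M|) :=
  colsub (fun k : 'I_#|M| => enum_val k) X.

Definition all_submodels X : {set {set 'I_p}} :=
  [set M : {set 'I_p} | (M != finset.set0) && (\rank (submodel_mx X M) == #|M|)].

Definition least_squares X M y : 'cV[R]_#|M| :=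
  let XM := submodel_mx X M in invmx (XM^T *m XM) *m XM^T *m y.

(* Orthogonal projection onto the column space of A, acting on row vectors on
   the right: the row space of kermx A is the orthogonal complement of the row
   space of A^T. *)
Definition ortho_proj m (A : 'M[R]_(n, m)) : 'M[R]_n :=
  proj_mx <<A^T>>%MS (kermx A).

Definition residual X M (j : 'I_p) : 'cV[R]_n :=
  let x := (col j X)^T in
  (x - x *m ortho_proj (submodel_mx X (M :\ j)))^T.

(* y and s are the realized values of the response and of sigma hat;
   least_squares X M mu is the expectation of the estimate in the submodel M. *)
Definition t_stat X mu y (s : R) M (k : 'I_#|M|) : R :=
  (least_squares X M y k 0 - least_squares X M mu k 0) /
  (s / euclidean_norm (residual X M (enum_val k))).

(* For nonempty M the base value 0 does not affect the maximum. *)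
Definition max_abs_t X mu y s M : R :=
  \big[Order.max/0]_(k < #|M|) `|t_stat X mu y s k|.

End LeastSquares.

Section ChiSquared.
Context {R : realType}.

Definition gamma_fun (a : R) : R :=
  \int[lebesgue_measure]_(x in `]0, +oo[) (x `^ (a - 1) * expR (- x)).

Definition chi2_pdf (k : nat) (x : R) : R :=
  if 0 < x then
    x `^ (k%:R / 2 - 1) * expR (- x / 2) /
    (2 `^ (k%:R / 2) * gamma_fun (k%:R / 2))
  else 0.

Definition chi2_prob (k : nat) (A : set R) : \bar R :=
  (\int[lebesgue_measure]_(x in A) (chi2_pdf k x)%:E)%E.

End ChiSquared.

Section Setting.
Context {d : measure_display} {T : measurableType d} {R : realType}.
Context (P : probability T R) {n p : nat}.
Implicit Types (X : 'M[R]_(n, p)) (mu : 'cV[R]_n) (Y : {RV P >-> n.-tuple R}).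
Implicit Types (sigma : R) (sigmahat : {RV P >-> R}).

(* n.-tuple R carries the sigma-algebra generated by the coordinates, that is
   the Borel sigma-algebra of R^n. *)
Definition col_of_tuple (y : n.-tuple R) : 'cV[R]_n := \col_i tnth y i.

(* Y ~ N(mu, sigma^2 I_n); the second argument of normal_prob is the standard
   deviation. *)
Definition is_spherical_normal mu sigma Y : Prop :=
  forall A : 'I_n -> set R, (forall i, measurable (A i)) ->
  P [set w | forall i, A i (tnth (Y w) i)] =
  (\prod_(i < n) normal_prob (mu i 0)%R sigma (A i))%E.

(* sigmahat^2 ~ sigma^2 chi^2_r / r; None stands for r = infinity. *)
Definition is_scaled_chi2 sigma (r : option nat) sigmahat : Prop :=
  match r with
  | Some k => (0 < k)%N /\
      forall A : set R, measurable A ->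
      P [set w | A (sigmahat w ^+ 2)] =
      chi2_prob k [set x | A (sigma ^+ 2 * x / k%:R)]
  | None => forall w, sigmahat w = sigma
  end.

(* The generators of the sigma-algebra spanned by all least squares estimates
   jointly. *)
Definition least_squares_events X Y : set (set T) :=
  [set E | exists M : {set 'I_p}, M \in all_submodels X /\
    exists (k : 'I_#|M|) (A : set R), measurable A /\
      E = [set w | A (least_squares X M (col_of_tuple (Y w)) k 0)]].

Definition independent_of_least_squares X Y sigmahat : Prop :=
  forall (E : set T) (B : set R),
  <<s least_squares_events X Y >> E -> measurable B ->
  P (E `&` sigmahat @^-1` B) = (P E * P (sigmahat @^-1` B))%E.

(* K(X, Ms, alpha, r): the law of the simultaneous maximum is determined by X,
   Ms and the degrees of freedom r, so this is the same number for all P, mu,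
   Y, sigmahat satisfying the assumptions of the model. The infimum is a minimum
   for 0 < alpha < 1, by right-continuity of the distribution function. *)
Definition posi_constant X (Ms : {set {set 'I_p}}) mu Y sigmahat (alpha : R) : R :=
  inf [set K : R | ((1 - alpha)%:E <=
    P [set w | (\big[Order.max/0]_(M in Ms)
      max_abs_t X mu (col_of_tuple (Y w)) (sigmahat w) M <= K)%R])%E].

End Setting.

(* Main.v *)
Require Import Defs.
From HB Require Import structures.
From mathcomp Require Import all_boot all_order all_algebra.
From mathcomp Require Import all_classical all_reals all_analysis.
From mathcomp Require Import measurable_realfun.

Set Implicit Arguments.
Unset Strict Implicit.
Unset Printing Implicit Defensive.

Import Order.TTheory GRing.Theory Num.Theory.
Import numFieldNormedType.Exports.

Local Open Scope classical_set_scope.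
Local Open Scope ring_scope.

(** The selected model always belongs to Ms, so pointwise, and whatever the
    selection rule, the maximal statistic in the selected model is at most the
    maximum S of the statistics over all models in Ms. Hence the event that
    S <= K is contained in the event that the selected maximum is at most K,
    and the theorem follows by monotonicity of P from P (S <= K) >= 1 - alpha.

    For this last inequality, K is given as the infimum of the levels k with
    1 - alpha <= P (S <= k), i.e. as a quantile of S, and one has to see that
    this infimum is attained. This is [cdf_quantile_ge]: the set of such levels
    is nonempty and bounded below because the distribution function of S has
    limits 1 and 0 at +oo and -oo and 0 < 1 - alpha < 1, and it contains its
    infimum because the distribution function is right-continuous.

    Both steps use that S and the selected maximum are measurable. The first is
    a finite maximum of measurable functions of Y and sigmahat
    ([measurable_max_abs_t]); for the second, the event that it is at most K is
    the finite union over M of the events that M is selected and the maximum in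
    M is at most K. *)

Section Quantile.
Context d (T : measurableType d) (R : realType) (P : probability T R).

Lemma cdfE (S : {RV P >-> R}) (x : R) : cdf S x = P [set w | S w <= x].
Proof. by rewrite /cdf /distribution /pushforward; congr (P _). Qed.

(** To the right of the infimum every point is above some level k with
    c <= cdf S k, hence is such a level itself by monotonicity; the inequality
    passes to the limit from the right. *)
Lemma cdf_quantile_ge (S : {RV P >-> R}) (c : R) : 0 < c -> c < 1 ->
  (c%:E <= cdf S (inf [set x : R | (c%:E <= cdf S x)%E]))%E.
Proof.
move=> c0 c1; set L := [set x | _].
have L0 : L !=set0.
  have : \forall x \near +oo%R, (c%:E < cdf S x)%E.
    apply: (@cvg_cdfy1 _ _ _ _ S [set y | c%:E < y]%E); apply: open_ereal_gt'.
    by rewrite lte_fin.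
  by move=> /filter_ex[x /ltW]; exists x.
have Llb : has_lbound L.
  have : \forall x \near -oo%R, (cdf S x < c%:E)%E.
    apply: (@cvg_cdfNy0 _ _ _ _ S [set y | y < c%:E]%E); apply: open_ereal_lt'.
    by rewrite lte_fin.
  move=> /filter_ex[x xc]; exists x => y /= cy.
  rewrite leNgt; apply/negP => yx.
  have := lt_le_trans (le_lt_trans (cdf_nondecreasing S (ltW yx)) xc) cy.
  by rewrite ltxx.
apply: (@cvge_ge _ _ (at_right_proper_filter (inf L)) _ (cdf S)); last first.
  exact: cdf_right_continuous.
near=> x.
have : inf L < x by near: x; exact: nbhs_right_gt.
move=> /(inf_lt L0)[y Ly yx].
exact: le_trans Ly (cdf_nondecreasing S (ltW yx)).
Unshelve. all: by end_near. Qed.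

End Quantile.

Section Measurability.
Context d (T : measurableType d) (R : realType).

Lemma measurable_bigmaxr (I : Type) (s : seq I) (Q : pred I) (x0 : R)
    (h : I -> T -> R) :
  (forall i, Q i -> measurable_fun setT (h i)) ->
  measurable_fun setT (fun w => \big[Order.max/x0]_(i <- s | Q i) h i w).
Proof.
move=> mh; elim: s => [|i s IHs].
  by under eq_fun do rewrite big_nil; exact: measurable_cst.
under eq_fun do rewrite big_cons.
case: (boolP (Q i)) => // Qi; apply: measurable_maxr => //; exact: mh.
Qed.

Context (n p : nat) (X : 'M[R]_(n, p)) (mu : 'cV[R]_n).
Context (Y : T -> n.-tuple R) (s : T -> R).
Context (Y_meas : measurable_fun setT Y) (s_meas : measurable_fun setT s).
Context (s_ge0 : forall w, 0 <= s w).

Lemma measurable_least_squares (M : {set 'I_p}) (k : 'I_#|M|) :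
  measurable_fun setT (fun w => least_squares X M (col_of_tuple (Y w)) k 0).
Proof.
rewrite /least_squares; set A := (_ *m _).
under eq_fun do rewrite mxE.
apply: measurable_sum => j.
apply: measurable_funM; first exact: measurable_cst.
under eq_fun do rewrite mxE.
exact: (measurableT_comp (measurable_tnth j) Y_meas).
Qed.

(** Only Y and s vary with w: the norm of the residual vector is a constant, so
    the statistic is an affine function of Y times a multiple of the inverse of
    s. *)
Lemma measurable_max_abs_t (M : {set 'I_p}) :
  measurable_fun setT
    (fun w => max_abs_t X mu (col_of_tuple (Y w)) (s w) M).
Proof.
apply: measurable_bigmaxr => k _.
apply: (measurableT_comp (@normr_measurable R setT)).
rewrite /t_stat; apply: measurable_funM.
  by apply: measurable_funB; [exact: measurable_least_squares|
                             exact: measurable_cst].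
(* On nonnegative reals the inverse is the power with exponent -1, which is
   measurable, and x / (s / c) = x * (c / s) even when c or s is zero. *)
under eq_fun do rewrite invf_div -powR_inv1//.
apply: measurable_funM; first exact: measurable_cst.
exact: (measurableT_comp (measurable_powR _) s_meas).
Qed.

End Measurability.

Theorem theorem4p1 (R : realType) (n p : nat) (X : 'M[R]_(n, p))
  (rank_ge1 : (1 <= \rank X)%N)
  (Ms : {set {set 'I_p}})
  (Ms_sub : Ms \subset all_submodels X)
  (Ms_neq0 : Ms != finset.set0)
  (Ms_cover : finset.cover Ms = finset.setT)
  (d : measure_display) (T : measurableType d) (P : probability T R)
  (mu : 'cV[R]_n) (sigma : R) (sigma_gt0 : 0 < sigma)
  (Y : {RV P >-> n.-tuple R})
  (Y_normal : is_spherical_normal mu sigma Y)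
  (r : option nat) (sigmahat : {RV P >-> R})
  (sigmahat_gt0 : forall w, 0 < sigmahat w)
  (sigmahat_law : is_scaled_chi2 sigma r sigmahat)
  (sigmahat_indep : independent_of_least_squares X Y sigmahat)
  (alpha : R) (alpha_gt0 : 0 < alpha) (alpha_lt1 : alpha < 1)
  (Mhat : n.-tuple R -> {set 'I_p})
  (Mhat_in : forall y, Mhat y \in Ms)
  (Mhat_meas : forall M : {set 'I_p}, measurable [set y | Mhat y = M]) :
  ((1 - alpha)%:E <=
    P [set w | (max_abs_t X mu (col_of_tuple (Y w)) (sigmahat w) (Mhat (Y w))
                <= posi_constant X Ms mu Y sigmahat alpha)%R])%E.
Proof.
pose t (M : {set 'I_p}) w := max_abs_t X mu (col_of_tuple (Y w)) (sigmahat w) M.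
have t_meas M : measurable_fun setT (t M).
  by apply: measurable_max_abs_t => // w; exact: ltW.
pose S w := \big[Order.max/0]_(M in Ms) t M w.
have S_meas : measurable_fun setT S by apply: measurable_bigmaxr.
pose S' : {RV P >-> R} :=
  HB.pack S (isMeasurableFun.Build _ _ _ _ S S_meas).
set K := posi_constant _ _ _ _ _ _.
have KE : K = inf [set x | ((1 - alpha)%:E <= cdf S' x)%E].
  by congr inf; apply/funext => x /=; rewrite cdfE.
have SK : ((1 - alpha)%:E <= P [set w | (S w <= K)%R])%E.
  rewrite -(cdfE S') KE; apply: cdf_quantile_ge; first by rewrite subr_gt0.
  by rewrite gtrBl.
have le_meas (f : T -> R) : measurable_fun setT f ->
    measurable [set w | f w <= K].
  move=> mf; have := mf measurableT _ (measurable_itv `]-oo, K]).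
  by rewrite setTI set_itvE.
apply: (le_trans SK); apply: le_measure; rewrite ?inE; last 1 first.
- by move=> w /=; apply: le_trans; exact: (le_bigmax_cond _ (t^~ w)).
- exact: le_meas.
rewrite [X in measurable X](_ : _ = \bigcup_(M in [set: {set 'I_p}])
    (Y @^-1` [set y | Mhat y = M] `&` [set w | t M w <= K])).
  apply: fin_bigcup_measurable => // M _; apply: measurableI; last exact: le_meas.
  by rewrite -[X in measurable X]setTI; exact: measurable_funP.
apply/seteqP; split=> w /=; first by exists (Mhat (Y w)).
by case=> M _ [<-].
Qed.
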